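(* Let $\beta>1/2$ and let $X$ be a random variable with density $f_\beta(x)=C_\beta(1+x^2)^{-\beta}$, $x\in\mathbb R$. Then for every $1\le p<\infty$ and every smooth $\phi:\mathbb R\to\mathbb R$ with $E[|\phi(X)|^p]<\infty$, $$E\big[|\phi(X)-E(\phi(X))|^p\big]\le 2^\beta\Big(\frac{2p}{2\beta-1}\Big)^p E\big[(1+|X|)^p|\phi'(X)|^p\big].$$
   Context: $C_\beta>0$ is the normalizing constant making $f_\beta$ a probability density on $\mathbb R$. *)

(* Defs.v *)
From HB Require Import structures.
From mathcomp Require Import all_boot all_order all_algebra.
From mathcomp Require Import all_classical all_reals all_analysis.
Set Implicit Arguments. Unset Strict Implicit. Unset Printing Implicit Defensive.
Import Order.TTheory GRing.Theory Num.Theory.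
Import numFieldNormedType.Exports.
Local Open Scope classical_set_scope.
Local Open Scope ring_scope.

Definition gbeta {R : realType} (beta : R) (x : R) : R :=
  (1 + x ^+ 2) `^ (- beta).

Definition Cbeta {R : realType} (beta : R) : R :=
  (fine (\int[lebesgue_measure]_x (gbeta beta x)%:E))^-1.

Definition fbeta {R : realType} (beta : R) (x : R) : R :=
  Cbeta beta * gbeta beta x.

Definition smooth {R : realType} (phi : R -> R) : Prop :=
  forall (n : nat) (x : R), derivable (derive1n n phi) x 1.

(* Main.v *)
(* With a = 2 beta - 1, the weight (1 + |x|)^(-a-1) = (1 + |x|)^(-2 beta) is
   comparable to (1 + x^2)^(-beta) up to the factor 2^beta. For this weight the
   Hardy inequality holds on each half-line with constant (p/a)^p: for u(0) = 0,
   Young's inequality bounds the derivative of |u|^p (1 + x)^(-a) pointwise by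
     (a/p) ((p/a)^p ((1 + x) |u'|)^p - |u|^p) (1 + x)^(-a-1),
   and |u|^p (1 + x)^(-a) is nonnegative and vanishes at 0. Since |u|^p need
   not be differentiable, |u| is replaced by sqrt(u^2 + delta), delta -> 0.
   Finally, centring phi(X) at its mean instead of phi(0) costs at most the
   factor 2^p. *)
Require Import Defs.
From HB Require Import structures.
From mathcomp Require Import all_boot all_order all_algebra.
From mathcomp Require Import all_classical all_reals all_analysis.
From mathcomp Require Import measurable_realfun ring lra.
Set Implicit Arguments. Unset Strict Implicit. Unset Printing Implicit Defensive.
Import Order.TTheory GRing.Theory Num.Theory.
Import numFieldNormedType.Exports.
Local Open Scope classical_set_scope.
Local Open Scope ring_scope.

(** * Young's inequality and convexity of real powers *)

(** Young's inequality for [t] and the power of [s], with exponents p and p/(p-1). The case p = 1,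
    where the conjugate exponent is infinite, is checked directly; there s^0 = 1 even for s = 0. *)
Lemma young_powR {R : realType} (p s t : R) : 1 <= p -> 0 <= s -> 0 <= t ->
  s `^ (p - 1) * t <= t `^ p / p + (1 - p^-1) * s `^ p.
Proof.
rewrite le_eqVlt => /predU1P[<- s0 t0|p1 s0 t0].
  by rewrite subrr powRr0 mul1r powRr1// invr1 mulr1 subrr mul0r addr0.
have p0 : 0 < p by rewrite (lt_trans _ p1).
have q0 : 0 < p / (p - 1) by rewrite divr_gt0 ?subr_gt0.
have pq : p^-1 + (p / (p - 1))^-1 = 1 by field; lra.
have := conjugate_powR t0 (powR_ge0 s (p - 1)) p0 q0 pq.
rewrite -powRrM (_ : (p - 1) * (p / (p - 1)) = p); last by field; lra.
by rewrite mulrC (_ : (p / (p - 1))^-1 = 1 - p^-1) 1?[_ * (1 - _)]mulrC//; lra.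
Qed.

(** Young's inequality acts as the tangent-line bound for t^p at the midpoint [s]; taken at [x] and
    at [y] and summed, it gives midpoint convexity. *)
Lemma powR_addr_le {R : realType} (p x y : R) : 1 <= p -> 0 <= x -> 0 <= y ->
  (x + y) `^ p <= 2 `^ p / 2 * (x `^ p + y `^ p).
Proof.
move=> p1 x0 y0; have p0 : 0 < p by rewrite (lt_le_trans _ p1).
pose s := (x + y) / 2; have s0 : 0 <= s by rewrite divr_ge0 ?addr_ge0.
rewrite (_ : x + y = 2 * s); last by rewrite /s; lra.
rewrite powRM// -mulrA ler_pM2l ?powR_gt0//.
have := lerD (young_powR p1 s0 x0) (young_powR p1 s0 y0).
have -> : s `^ (p - 1) * x + s `^ (p - 1) * y = 2 * s `^ p.
  by rewrite -(mulr_powRB1 s0 p0) /s; lra.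
set A := s `^ p; set B := x `^ p; set C := y `^ p => h.
rewrite -(@ler_pM2l _ (2 / p)) ?divr_gt0//.
have pV : p^-1 * p = 1 by rewrite mulVf// gt_eqF.
by lra.
Qed.

(** * Weighted Hardy inequality on intervals, half-lines and the line *)

(** Here [v] stands for a regularised |u|, [d] for u' and [c] for 1 + x. With v = sqrt(u^2 + delta),
    the bracket times c^(-a-1) is the derivative of v^p c^(-a). The bound is Young's inequality with
    s = v and t = (p/a) c |d|. *)
Lemma hardy_pointwise {R : realType} (p a u d v c : R) :
  1 <= p -> 0 < a -> `|u| <= v -> 0 < v -> 0 < c ->
  v `^ p + p / a * (p * (u * d) * v `^ (p - 2) * c - a * v `^ p)
    <= (p / a) `^ p * (c `^ p * `|d| `^ p).
Proof.
move=> p1 a0 uv v0 c0; have p0 : 0 < p by rewrite (lt_le_trans _ p1).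
have pa0 : 0 < p / a by rewrite divr_gt0.
have t0 : 0 <= p / a * (c * `|d|) by rewrite mulr_ge0 ?(ltW pa0)// mulr_ge0// ltW.
have := young_powR p1 (ltW v0) t0.
rewrite [(p / a * (c * _)) `^ p]powRM ?(ltW pa0)//; last by rewrite mulr_ge0// ltW.
rewrite [(c * _) `^ p]powRM ?(ltW c0)//.
set J := _ `^ p * _ => h.
(* The bound |u| <= v absorbs the factor [u] into one more power of [v]. *)
have ud : u * d * v `^ (p - 2) <= v `^ (p - 1) * `|d|.
  rewrite (_ : p - 1 = 1 + (p - 2)); last by lra.
  rewrite [v `^ (1 + _)]powRD; last by rewrite (gt_eqF v0) implybT.
  rewrite powRr1 ?(ltW v0)// [leRHS]mulrAC ler_wpM2r ?powR_ge0//.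
  by rewrite (le_trans (ler_norm _))// normrM ler_wpM2r.
have : p * (p / a * c * (u * d * v `^ (p - 2))) <=
       p * (J / p + (1 - p^-1) * v `^ p).
  rewrite ler_pM2l//; apply: le_trans h.
  rewrite (_ : v `^ (p - 1) * _ = p / a * c * (v `^ (p - 1) * `|d|)); last by ring.
  by rewrite ler_wpM2l// mulr_ge0// ltW.
set A := v `^ p; set B := v `^ (p - 2).
have -> : p * (J / p + (1 - p^-1) * A) = J + (p - 1) * A by field; lra.
have -> : p / a * (p * (u * d) * B * c - a * A) =
          p * (p / a * c * (u * d * B)) - p * A by field; lra.
by lra.
Qed.

Lemma is_derive_comp_powR {R : realType} (f : R -> R) (x df r : R) : 0 < f x ->
  is_derive x 1 f df ->
  is_derive x 1 (fun y => f y `^ r) (r * f x `^ (r - 1) * df).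
Proof.
move=> fx0 hf.
have h := is_derive1_powR r fx0.
by apply: is_derive_eq; [exact: is_derive1_comp|rewrite mulrC].
Qed.

Lemma continuous_comp_powR {R : realType} (f : R -> R) (x r : R) : 0 < f x ->
  {for x, continuous f} -> {for x, continuous (fun y => f y `^ r)}.
Proof.
move=> fx0 cf.
have : {for f x, continuous (@powR R ^~ r)}.
  apply/differentiable_continuous/derivable1_diffP/derivable_powR.
  by rewrite in_itv/= andbT.
by move=> cp; exact: (continuous_comp cf cp).
Qed.

Lemma measurable_comp_powR {d : measure_display} {T : measurableType d}
    {R : realType} (D : set T) (f : T -> R) (r : R) :
  measurable_fun D f -> measurable_fun D (fun x => f x `^ r).
Proof. exact: (measurableT_comp (measurable_powR r)). Qed.

(** Integrating the pointwise bound against the weight turns the bracket into G(N) - G(0). The term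
    G(N) is nonnegative, and G(0) = delta^(p/2) is the price of the regularisation. *)
Lemma hardy_itv_delta {R : realType} (u du : R -> R) (p a delta N : R) :
  1 <= p -> 0 < a -> 0 < delta -> 0 < N ->
  (forall x : R, is_derive x 1 u (du x)) -> continuous du -> u 0 = 0 ->
  (\int[lebesgue_measure]_(x in `[0%R, N])
      (`|u x| `^ p * (1 + x) `^ (- a - 1))%:E <=
   ((p / a) `^ p)%:E * \int[lebesgue_measure]_(x in `[0%R, N])
      ((1 + x) `^ p * `|du x| `^ p * (1 + x) `^ (- a - 1))%:E
   + (p / a * delta `^ (p / 2))%:E)%E.
Proof.
move=> p1 a0 d0 N0 hu cdu u0.
have p0 : 0 < p by rewrite (lt_le_trans _ p1).
pose mu := @lebesgue_measure R.
have cu : continuous u.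
  by move=> x; apply/differentiable_continuous/derivable1_diffP; exact: ex_derive.
(* The square root of [f] regularises |u|: [f] stays positive, so all its real powers are
   differentiable. *)
pose f x := u x ^+ 2 + delta.
have f0 (x : R) : 0 < f x by rewrite ltr_wpDl// sqr_ge0.
pose w x : R := (1 + x) `^ (- a - 1).
pose G x := f x `^ (p / 2) * (1 + x) `^ (- a).
pose g x := f x `^ (p / 2) * (- a * w x) +
            (1 + x) `^ (- a) * (p / 2 * f x `^ (p / 2 - 1) * (2 * u x * du x)).
have cf : continuous f.
  move=> x; apply: cvgD; last exact: cvg_cst.
  by apply: cvgM; exact: cu.
have c1 (x : R) : {for x, continuous (fun y : R => 1 + y)}.
  by apply: cvgD; [exact: cvg_cst|exact: cvg_id].
have hG (x : R) : 0 < 1 + x -> is_derive x 1 G (g x).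
  move=> x0.
  have df : is_derive x 1 f (2 * u x * du x).
    rewrite /f; have hux := hu x.
    apply: is_derive_eq.
    by rewrite addr0 -[RHS]mulrA mulr_natl mulr2n.
  have d1 : is_derive x 1 (fun y : R => 1 + y) 1.
    by apply: is_derive_eq; rewrite add0r mulr1.
  have h1 := is_derive_comp_powR (p / 2) (f0 x) df.
  have h2 := is_derive_comp_powR (- a) x0 d1.
  have h3 := is_deriveM h1 h2; apply: (is_derive_eq h3).
  by rewrite /g /w mulr1.
have dG (x : R) : 0 < 1 + x -> {for x, continuous G}.
  by move=> /hG hx; apply/differentiable_continuous/derivable1_diffP; exact: ex_derive.
have cfr (r x : R) : {for x, continuous (fun y => f y `^ r)}.
  exact: continuous_comp_powR (f0 x) (cf x).
have c1r (r x : R) : 0 < 1 + x -> {for x, continuous (fun y : R => (1 + y) `^ r)}.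
  by move=> x0; exact: continuous_comp_powR x0 (c1 x).
have cg (x : R) : 0 < 1 + x -> {for x, continuous g}.
  move=> x0; apply: cvgD; apply: cvgM.
  - exact: cfr.
  - by apply: cvgM; [exact: cvg_cst|exact: c1r].
  - exact: c1r.
  - apply: cvgM; first by apply: cvgM; [exact: cvg_cst|exact: cfr].
    by apply: cvgM; [apply: cvgM; [exact: cvg_cst|exact: cu]|exact: cdu].
pose h x := f x `^ (p / 2) * w x.
have ch (x : R) : 0 < 1 + x -> {for x, continuous h}.
  by move=> x0; apply: cvgM; [exact: cfr|exact: c1r].
have x10 (x : R) : x \in `[0, N] -> 0 < 1 + x.
  by rewrite in_itv/= => /andP[x0 _]; rewrite ltr_pwDl.
have cont (k : R -> R) : (forall x : R, 0 < 1 + x -> {for x, continuous k}) ->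
    {within `[0, N], continuous k}.
  by move=> hk; apply: continuous_in_subspaceT => x /[!inE] xN; exact/hk/x10.
have int (k : R -> R) : {within `[0, N], continuous k} -> mu.-integrable `[0, N] (EFin \o k).
  by move=> hk; apply: continuous_compact_integrable => //; exact: segment_compact.
have FTC : (\int[mu]_(x in `[0%R, N]) (g x)%:E = (G N)%:E - (G 0)%:E)%E.
  apply: continuous_FTC2 => //; first exact: cont.
  - split => [x xN||].
    + have /hG h1 : 0 < 1 + x by apply: x10; exact: subset_itv_oo_cc.
      exact: ex_derive.
    + by apply: cvg_at_right_filter; apply: dG; rewrite addr0.
    + by apply: cvg_at_left_filter; apply: dG; rewrite addr_gt0.
  - move=> x xN; have /hG h1 : 0 < 1 + x by apply: x10; exact: subset_itv_oo_cc.
    by rewrite derive1E derive_val.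
have fv (x : R) : f x `^ (p / 2) = (f x `^ 2^-1) `^ p by rewrite -powRrM mulrC.
have fv2 (x : R) : f x `^ (p / 2 - 1) = (f x `^ 2^-1) `^ (p - 2).
  by rewrite -powRrM; congr (_ `^ _); lra.
have uv (x : R) : `|u x| <= f x `^ 2^-1.
  rewrite powR12_sqrt ?(ltW (f0 x))// -sqrtr_sqr ler_sqrt ?(ltW (f0 x))//.
  by rewrite /f lerDl ltW.
pose j (x : R) := (1 + x) `^ p * `|du x| `^ p * w x.
pose J := (\int[mu]_(x in `[0%R, N]) (j x)%:E)%E.
change (\int[mu]_(x in `[0%R, N]) (`|u x| `^ p * w x)%:E <=
  ((p / a) `^ p)%:E * J + (p / a * delta `^ (p / 2))%:E)%E.
have J0 : (0 <= J)%E.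
  by apply: integral_ge0 => x _; rewrite lee_fin !mulr_ge0// powR_ge0.
(* An infinite [J] makes the bound trivial; a finite one makes [j] integrable, as needed for
   linearity and monotonicity of the integrals of signed functions below. *)
have [Joo|Jfin] := eqVneq J +oo%E.
  rewrite Joo gt0_muley ?lte_fin ?powR_gt0 ?divr_gt0// addye ?leey//.
have mw : measurable_fun [set: R] w.
  by apply: measurable_comp_powR; exact: measurable_funD.
have mj : measurable_fun [set: R] j.
  apply: measurable_funM => //; apply: measurable_funM.
  - by apply: measurable_comp_powR; exact: measurable_funD.
  - apply: measurable_comp_powR; apply: measurableT_comp => //.
    exact: continuous_measurable_fun.
have intj : mu.-integrable `[0, N] (EFin \o j).
  apply/integrableP; split; first exact/measurable_EFinP/measurable_funTS.
  under eq_integral.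
    move=> x _; rewrite gee0_abs; last by rewrite lee_fin !mulr_ge0// powR_ge0.
    over.
  by rewrite ltey.
have ih := int h (cont _ ch).
have ig := int g (cont _ cg).
have key : (\int[mu]_(x in `[0%R, N]) (h x)%:E + (p / a)%:E * ((G N)%:E - (G 0)%:E)
    <= ((p / a) `^ p)%:E * J)%E.
  rewrite -FTC -integralZl// -integralZl// -integralD//=; last exact: integrableZl.
  apply: le_integral => //.
  - by apply: integrableD => //; exact: integrableZl.
  - exact: integrableZl.
  - move=> x /[!inE] xN /=; rewrite lee_fin.
    have x0 := x10 _ xN.
    have vx0 : 0 < f x `^ 2^-1 by rewrite powR_gt0.
    have := hardy_pointwise (du x) p1 a0 (uv x) vx0 x0.
    move=> /(ler_wpM2r (powR_ge0 (1 + x) (- a - 1))).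
    rewrite /h /g -fv -fv2.
    (* This exposes the common factor [w x], so that [g x] becomes the bracket of [hardy_pointwise]
       times the weight. *)
    have -> : (1 + x) `^ (- a) = (1 + x) * w x.
      rewrite /w powRD; last by rewrite (gt_eqF x0) implybT.
      by rewrite powR_inv1 ?(ltW x0)// mulrCA divff ?gt_eqF// mulr1.
    rewrite -/(w x).
    set A := f x `^ (p / 2); set B := f x `^ (p / 2 - 1).
    move=> H; apply: le_trans (le_trans H _); last by rewrite /j !mulrA.
    by rewrite le_eqVlt; apply/orP; left; apply/eqP; field; lra.
apply: (@le_trans _ _ (\int[mu]_(x in `[0%R, N]) (h x)%:E)%E).
  apply: ge0_le_integral => //.
  - by move=> x _; rewrite lee_fin mulr_ge0// powR_ge0.
  - apply/measurable_EFinP/measurable_funTS; apply: measurable_funM => //.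
    apply: measurable_comp_powR; apply: measurableT_comp => //.
    exact: continuous_measurable_fun.
  - exact: measurable_int ih.
  - move=> x _; rewrite lee_fin ler_wpM2r ?powR_ge0// fv.
    by apply: ge0_ler_powR; rewrite ?nnegrE ?powR_ge0// ltW.
(* Since u(0) = 0, the boundary term at 0 equals the error term exactly, and what remains is (p/a)
   G(N) >= 0. *)
rewrite -leeBlDr//; apply: le_trans key.
rewrite leeD2l// -EFinB -EFinM -EFinN lee_fin.
rewrite mulrBr /G /f u0 expr0n/= add0r addr0 powR1 mulr1.
rewrite lerDr; apply: mulr_ge0; first by rewrite divr_ge0 ?ltW.
by rewrite mulr_ge0 ?powR_ge0.
Qed.

Lemma hardy_itv {R : realType} (u du : R -> R) (p a N : R) :
  1 <= p -> 0 < a -> 0 < N ->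
  (forall x : R, is_derive x 1 u (du x)) -> continuous du -> u 0 = 0 ->
  (\int[lebesgue_measure]_(x in `[0%R, N])
      (`|u x| `^ p * (1 + x) `^ (- a - 1))%:E <=
   ((p / a) `^ p)%:E * \int[lebesgue_measure]_(x in `[0%R, N])
      ((1 + x) `^ p * `|du x| `^ p * (1 + x) `^ (- a - 1))%:E)%E.
Proof.
move=> p1 a0 N0 hu cdu u0; apply/lee_addgt0Pr => e e0.
have p0 : 0 < p by rewrite (lt_le_trans _ p1).
(* This choice of delta makes the error (p/a) delta^(p/2) equal to [e]. *)
have d0 : 0 < (e * a / p) `^ (2 / p) by rewrite powR_gt0 ?divr_gt0 ?mulr_gt0.
have := hardy_itv_delta p1 a0 d0 N0 hu cdu u0.
have -> : p / a * ((e * a / p) `^ (2 / p)) `^ (p / 2) = e => //.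
rewrite -powRrM (_ : 2 / p * (p / 2) = 1); last by field; lra.
by rewrite powRr1; [field; lra|rewrite divr_ge0 ?mulr_ge0 ?ltW].
Qed.

(** The intervals [0, n] exhaust the half-line: the left-hand integrals converge monotonically,
    while each right-hand integral is at most the one over the half-line. *)
Lemma hardy_halfline {R : realType} (u du : R -> R) (p a : R) :
  1 <= p -> 0 < a ->
  (forall x : R, is_derive x 1 u (du x)) -> continuous du -> u 0 = 0 ->
  (\int[lebesgue_measure]_(x in `[0%R, +oo[)
      (`|u x| `^ p * (1 + x) `^ (- a - 1))%:E <=
   ((p / a) `^ p)%:E * \int[lebesgue_measure]_(x in `[0%R, +oo[)
      ((1 + x) `^ p * `|du x| `^ p * (1 + x) `^ (- a - 1))%:E)%E.
Proof.
move=> p1 a0 hu cdu u0.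
have cu : continuous u.
  by move=> x; apply/differentiable_continuous/derivable1_diffP; exact: ex_derive.
have mw r : measurable_fun [set: R] (fun x : R => (1 + x) `^ r).
  by apply: measurable_comp_powR; exact: measurable_funD.
have mnp (v : R -> R) : continuous v -> measurable_fun [set: R] (fun x => `|v x| `^ p).
  move=> cv; apply: measurable_comp_powR; apply: measurableT_comp => //.
  exact: continuous_measurable_fun.
pose I n := (\int[lebesgue_measure]_(x in `[0%R, (0 + n%:R)%R])
  (`|u x| `^ p * (1 + x) `^ (- a - 1))%:E)%E.
have cvgI : I n @[n --> \oo] --> (\int[lebesgue_measure]_(x in `[0%R, +oo[)
      (`|u x| `^ p * (1 + x) `^ (- a - 1))%:E)%E.
  rewrite itv_bndy_bigcup_BRight; apply: ge0_nondecreasing_set_cvg_integral => //.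
  - move=> m n mn; rewrite subsetEset; apply: subset_itvl.
    by rewrite bnd_simp !add0r ler_nat.
  - by move=> n; apply/measurable_EFinP/measurable_funTS/measurable_funM; [exact: mnp|exact: mw].
  - by move=> n x _; rewrite lee_fin mulr_ge0// powR_ge0.
rewrite -(cvg_lim _ cvgI)//; apply: lime_le; first by apply/cvg_ex; eexists; exact: cvgI.
(* For n = 0 the interval is a single null point, outside the scope of [hardy_itv], which asks for a
   positive length. *)
apply: nearW => -[|n].
  by rewrite /I addr0 set_itv1 integral_set1 mule_ge0// ?lee_fin ?powR_ge0//;
    apply: integral_ge0 => x _; rewrite lee_fin !mulr_ge0// powR_ge0.
rewrite /I add0r; apply: le_trans (hardy_itv p1 a0 _ hu cdu u0) _ => //.
rewrite lee_wpmul2l ?lee_fin ?powR_ge0//; apply: ge0_subset_integral => //=.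
- apply/measurable_EFinP/measurable_funTS; apply: measurable_funM; last exact: mw.
  by apply: measurable_funM; [exact: mw|exact: mnp].
- by move=> x _; rewrite lee_fin !mulr_ge0// powR_ge0.
- by apply: subset_itvl; rewrite bnd_simp.
Qed.

Lemma ge0_integral_fold {R : realType} (h : R -> \bar R) :
  measurable_fun [set: R] h -> (forall x, 0 <= h x)%E ->
  (\int[lebesgue_measure]_x h x = \int[lebesgue_measure]_(x in `[0%R, +oo[) h x
    + \int[lebesgue_measure]_(x in `[0%R, +oo[) h (- x)%R)%E.
Proof.
move=> mh h0.
rewrite (@ge0_integration_by_substitution0 _ (h \o -%R)); first last.
- by move=> x /=.
- exact: (measurableT_comp mh (@oppr_measurable _ _)).
under [X in (_ + X)%E]eq_integral do rewrite /= opprK.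
(* Dropping the null point 0 makes the negative half exactly the complement of the nonnegative
   one. *)
rewrite -(@integral_itv_bndo_bndc _ _ 0); last exact: measurable_funTS.
rewrite -(setUv (`[0%R, +oo[%classic : set R)) ge0_integral_setU//=.
- by rewrite setCitvr.
- exact: measurableC.
- by rewrite setUv.
- exact/disj_setPCl.
Qed.

(** The weight is even, so folding at 0 leaves two half-line inequalities, for phi(x) - phi(0) and
    phi(-x) - phi(0). Both functions vanish at 0, and reflection changes only the sign of the
    derivative. *)
Lemma hardy_line {R : realType} (phi dphi : R -> R) (p a : R) :
  1 <= p -> 0 < a ->
  (forall x : R, is_derive x 1 phi (dphi x)) -> continuous dphi ->
  (\int[lebesgue_measure]_x
      (`|phi x - phi 0%R| `^ p * (1 + `|x|) `^ (- a - 1))%:E <=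
   ((p / a) `^ p)%:E * \int[lebesgue_measure]_x
      ((1 + `|x|) `^ p * `|dphi x| `^ p * (1 + `|x|) `^ (- a - 1))%:E)%E.
Proof.
move=> p1 a0 hphi cdphi.
have cphi : continuous phi.
  by move=> x; apply/differentiable_continuous/derivable1_diffP; exact: ex_derive.
have mw r : measurable_fun [set: R] (fun x : R => (1 + `|x|) `^ r).
  by apply: measurable_comp_powR; exact: measurable_funD.
have mnp (v : R -> R) : continuous v -> measurable_fun [set: R] (fun x => `|v x| `^ p).
  move=> cv; apply: measurable_comp_powR; apply: measurableT_comp => //.
  exact: continuous_measurable_fun.
rewrite !ge0_integral_fold; first last.
- by move=> x; rewrite lee_fin mulr_ge0// powR_ge0.
- apply/measurable_EFinP/measurable_funM; last exact: mw.
  by apply: mnp => x; apply: cvgB; [exact: cphi|exact: cvg_cst].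
- by move=> x; rewrite lee_fin !mulr_ge0// powR_ge0.
- apply/measurable_EFinP/measurable_funM; last exact: mw.
  by apply: measurable_funM; [exact: mw|exact: mnp].
rewrite ge0_muleDr; first last.
- by apply: integral_ge0 => x _; rewrite lee_fin !mulr_ge0// powR_ge0.
- by apply: integral_ge0 => x _; rewrite lee_fin !mulr_ge0// powR_ge0.
have itv0 (x : R) : x \in (`[0%R, +oo[%classic : set R) -> `|x| = x.
  by rewrite inE/= in_itv/= andbT => x0; rewrite ger0_norm.
apply: leeD.
- have hu (x : R) : is_derive x 1 (fun y => phi y - phi 0) (dphi x).
    by have hx := hphi x; apply: is_derive_eq; rewrite subr0.
  have := hardy_halfline p1 a0 hu cdphi (subrr _).
  under eq_integral => x /itv0 x0 do rewrite -{2}x0.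
  under [X in (_ <= _ * X)%E -> _]eq_integral => x /itv0 x0 do rewrite -{1 3}x0.
  by [].
- have hu (x : R) : is_derive x 1 (fun y => phi (- y) - phi 0) (- dphi (- x)).
    have hx := hphi (- x).
    have h1 : is_derive x 1 (phi \o -%R) (dphi (- x) * -1) by exact: is_derive1_comp.
    by apply: is_derive_eq; rewrite subr0 mulrN1.
  have cd : continuous (fun x : R => - dphi (- x)).
    move=> x; apply: cvgN; apply: continuous_comp; last exact: cdphi.
    exact: opp_continuous.
  have u0 : phi (- 0) - phi 0 = 0 by rewrite oppr0 subrr.
  have := hardy_halfline p1 a0 hu cd u0.
  under eq_integral => x /itv0 x0 do rewrite -[in (1 + _)%R]x0 -(normrN x).
  under [X in (_ <= _ * X)%E -> _]eq_integral => x /itv0 x0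
    do rewrite normrN -{1 3}x0 -(normrN x).
  by [].
Qed.

(** * Integration against a measure given by a density *)

Section density.
Local Open Scope ereal_scope.
Context {d : measure_display} {T : measurableType d} {R : realType}.
Variables (mu nu : {measure set T -> \bar R}) (f : T -> R).
Hypotheses (mf : measurable_fun setT f) (f0 : forall x, (0 <= f x)%R).
Hypothesis nuE : forall A, measurable A -> nu A = \int[mu]_(x in A) (f x)%:E.

Import HBNNSimple.

Let density_indic (E : set T) : measurable E ->
  \int[nu]_x (\1_E x)%:E = \int[mu]_x ((\1_E x)%:E * (f x)%:E).
Proof.
move=> mE; rewrite integral_indic// setIT nuE// integral_mkcond.
apply: eq_integral => x _; rewrite patchE indicE.
by case: ifPn => _; rewrite ?mul1e ?mul0e.
Qed.

Let density_nnsfun (h : {nnsfun T >-> R}) :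
  \int[nu]_x (h x)%:E = \int[mu]_x ((h x)%:E * (f x)%:E).
Proof.
under [LHS]eq_integral do rewrite fimfunE -fsumEFin//.
rewrite [LHS]ge0_integral_fsum//; last 2 first.
- by move=> r; exact/measurable_EFinP/measurableT_comp.
- by move=> n x _; rewrite EFinM nnfun_muleindic_ge0.
under [RHS]eq_integral.
  move=> x _; rewrite fimfunE -fsumEFin// muleC ge0_mule_fsumr; last first.
    by move=> r; rewrite EFinM nnfun_muleindic_ge0.
  over.
rewrite [RHS]ge0_integral_fsum//; last 2 first.
- move=> r; apply: emeasurable_funM; first exact/measurable_EFinP.
  exact/measurable_EFinP/measurableT_comp.
- move=> n x _; apply: mule_ge0; first by rewrite lee_fin.
  by rewrite EFinM nnfun_muleindic_ge0.
apply: eq_fsbigr => r /[!inE] -[t _ <-].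
rewrite integralZl_indic_nnsfun// density_indic//.
under [RHS]eq_integral do rewrite muleC EFinM -muleA.
rewrite ge0_integralZl ?lee_fin//.
- apply: emeasurable_funM; last exact/measurable_EFinP.
  exact/measurable_EFinP.
- by move=> x _; rewrite mule_ge0 ?lee_fin.
Qed.

(** The hypothesis [nuE] settles indicators, finite sums settle simple functions, and monotone
    convergence does the rest; since f >= 0, multiplying by [f] keeps the approximating sequence
    increasing. *)
Lemma ge0_integral_density (g : T -> \bar R) :
  measurable_fun setT g -> (forall x, 0 <= g x) ->
  \int[nu]_x g x = \int[mu]_x (g x * (f x)%:E).
Proof.
move=> mg g0.
pose g_ := nnsfun_approx measurableT mg.
have cvg_g x : (g_ n x)%:E @[n --> \oo] --> g x.
  by apply: cvg_nnsfun_approx => // y _.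
have nd_g x : nondecreasing_seq (fun n => (g_ n x)%:E).
  by move=> m n mn; rewrite lee_fin; exact/lefP/nd_nnsfun_approx.
transitivity (limn (fun n => \int[nu]_x (g_ n x)%:E)).
  rewrite -monotone_convergence//=.
  - by apply: eq_integral => x _; apply/esym/cvg_lim.
  - by move=> n; exact/measurable_EFinP.
  - by move=> n x _; rewrite lee_fin.
under eq_fun do rewrite density_nnsfun.
rewrite -monotone_convergence//=.
- apply: eq_integral => x _; apply/cvg_lim => //.
  by apply: cvgeZr => //.
- by move=> n; apply: emeasurable_funM; exact/measurable_EFinP.
- by move=> n x _; rewrite mule_ge0 ?lee_fin.
- by move=> x _ m n mn; rewrite lee_wpmul2r ?lee_fin//; exact: nd_g.
Qed.

End density.

(** * Recentring a p-th moment at the mean *)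

(** With Z = Y - c, the centred variable is Z - E Z. Convexity bounds its p-th moment by 2^(p-1)
    (E|Z|^p + |E Z|^p), and Jensen's inequality bounds the second term by the first. *)
Lemma central_powR_moment_le {R : realType} {d : measure_display} {T : measurableType d}
    (P : probability T R) (Y : T -> R) (p c : R) : 1 <= p ->
  measurable_fun setT Y ->
  (\int[P]_w (`|Y w - fine (\int[P]_w (Y w)%:E)| `^ p)%:E <=
   (2 `^ p)%:E * \int[P]_w (`|Y w - c| `^ p)%:E)%E.
Proof.
move=> p1 mY; have p0 : 0 < p by rewrite (lt_le_trans _ p1).
set M := (\int[P]_w (`|Y w - c| `^ p)%:E)%E.
have M0 : (0 <= M)%E by apply: integral_ge0 => x _; rewrite lee_fin powR_ge0.
(* The infinite case is trivial and covers every non-integrable [Y], where [fine] may return a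
   default value in place of a mean. *)
have [->|Mfin] := eqVneq M +oo%E; first by rewrite gt0_muley ?leey// lte_fin powR_gt0.
have PT : (P : {measure set T -> \bar R}) [set: T] = 1%E by exact: probability_setT.
pose Z w := Y w - c.
pose Zp w := `|Z w| `^ p.
have mZ : measurable_fun setT Z by exact: measurable_funB.
have mN (X : T -> R) : measurable_fun setT X -> measurable_fun setT (fun w => `|X w| `^ p).
  by move=> mX; apply: measurable_comp_powR; exact: measurableT_comp.
have intZp : P.-integrable setT (EFin \o Zp).
  apply/integrableP; split; first by apply/measurable_EFinP; exact: mN.
  under eq_integral do rewrite gee0_abs ?lee_fin ?powR_ge0//.
  by rewrite ltey.
have int1 r : P.-integrable setT (EFin \o cst r).
  exact: finite_measure_integrable_cst.
have intZ : P.-integrable setT (EFin \o Z).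
  (* Young's inequality with s = 1 gives |Z| <= |Z|^p + 1, which is integrable for a probability
     measure. *)
  apply: (@le_integrable _ _ _ _ _ measurableT _
      (EFin \o Zp \+ (EFin \o cst 1%R))%E).
  - exact/measurable_EFinP.
  - move=> w _ /=; rewrite lee_fin [leRHS]ger0_norm ?addr_ge0 ?powR_ge0//.
    have := young_powR p1 ler01 (normr_ge0 (Z w)).
    rewrite powR1 mul1r mulr1 => /le_trans; apply.
    rewrite lerD//; last by rewrite gerBl invr_ge0 ltW.
    by rewrite ler_piMr ?powR_ge0// invf_le1.
  - exact: integrableD.
have intY : P.-integrable setT (EFin \o Y).
  apply: (eq_integrable measurableT (EFin \o Z \+ (EFin \o cst c))%E).
    by move=> w _ /=; rewrite -EFinD subrK.
  exact: integrableD.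
have fZ : (\int[P]_w (Z w)%:E)%E \is a fin_num by exact: integrable_fin_num intZ.
pose m := fine (\int[P]_w (Y w)%:E)%E.
have mE : (\int[P]_w (Z w)%:E)%E = (m - c)%:E.
  transitivity (\int[P]_w (Y w)%:E - \int[P]_w (cst c w)%:E)%E.
    by rewrite -integralB_EFin.
  rewrite (integral_cst P measurableT c%:E) PT mule1 EFinB fineK//.
  exact: integrable_fin_num intY.
pose s := `|m - c|.
have s0 : 0 <= s by exact: normr_ge0.
(* Jensen's inequality, obtained from Young's: for s = |E Z|, s^p <= E[s^(p-1) |Z|] <= M/p + (1 -
   1/p) s^p, and the last term is absorbed on the left. *)
have sp : ((s `^ p)%:E <= M)%E.
  have h1 : ((s `^ p)%:E <= \int[P]_w (s `^ (p - 1) * `|Z w|)%:E)%E.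
    under eq_integral do rewrite EFinM.
    rewrite integralZl//; last exact: integrable_norm.
    rewrite -(mulr_powRB1 s0 p0) mulrC EFinM lee_wpmul2l ?lee_fin ?powR_ge0//.
    rewrite -abse_EFin -mE; apply: le_abse_integral => //.
    exact/measurable_EFinP.
  have h2 : (\int[P]_w (s `^ (p - 1) * `|Z w|)%:E <=
      p^-1%:E * M + ((1 - p^-1) * s `^ p)%:E)%E.
    rewrite -integralZl// -[X in (_ + X)%E]mule1 -PT.
    rewrite -integral_cst// -integralD//; [|exact: integrableZl|exact: int1].
    apply: le_integral => //.
    - apply: (eq_integrable measurableT (fun w => (s `^ (p - 1))%:E * (`|Z w|)%:E)%E) => //.
      by apply: integrableZl => //; exact: integrable_norm.
    - by apply: integrableD => //; [exact: integrableZl|exact: int1].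
    - move=> w _; rewrite /= -EFinM -EFinD lee_fin.
      have := young_powR p1 s0 (normr_ge0 (Z w)).
      by rewrite [_ / p]mulrC.
  have := le_trans h1 h2.
  have Mf : M \is a fin_num by rewrite ge0_fin_numE// ltey.
  rewrite -(fineK Mf) -EFinM -EFinD !lee_fin => h3.
  rewrite -(@ler_pM2l _ p^-1) ?invr_gt0//; lra.
apply: (@le_trans _ _ (\int[P]_w ((2 `^ p / 2)%:E * ((`|Z w| `^ p)%:E + (s `^ p)%:E)))%E).
  apply: ge0_le_integral => //.
  - by apply/measurable_EFinP; apply: mN; exact: measurable_funB.
  - apply: emeasurable_funM => //; apply: emeasurable_funD => //.
    by apply/measurable_EFinP; exact: mN.
  - move=> w _; rewrite -EFinD -EFinM lee_fin -/m.
    apply: le_trans (powR_addr_le p1 (normr_ge0 _) s0).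
    apply: ge0_ler_powR; rewrite ?nnegrE ?addr_ge0 ?(ltW p0)//.
    have -> : Y w - m = Z w - (m - c) by rewrite /Z; ring.
    exact: ler_normB.
rewrite integralZl//; last by apply: integrableD => //; exact: (int1 (s `^ p)).
rewrite integralD//; last exact: (int1 (s `^ p)).
rewrite integral_cst// PT mule1 -/M.
apply: (@le_trans _ _ ((2 `^ p / 2)%:E * (M + M))%E).
  by rewrite lee_wpmul2l ?lee_fin ?divr_ge0 ?powR_ge0// leeD2l.
have Mf : M \is a fin_num by rewrite ge0_fin_numE// ltey.
by rewrite -(fineK Mf) -EFinD -!EFinM lee_fin; lra.
Qed.

(** * The law of X and the comparison of weights *)

(** The assumption on preimages says that the pushforward of [P] by [X] has density [f], so change
    of variables reduces the claim to [ge0_integral_density]. *)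
Lemma ge0_integral_law_density {d d' : measure_display} {W : measurableType d}
    {T : measurableType d'} {R : realType} (P : {measure set W -> \bar R})
    (mu : {measure set T -> \bar R}) (X : W -> T) (f : T -> R) (g : T -> \bar R) :
  measurable_fun setT X -> measurable_fun setT f -> (forall x, 0 <= f x) ->
  (forall A, measurable A -> P (X @^-1` A) = \int[mu]_(x in A) (f x)%:E)%E ->
  measurable_fun setT g -> (forall x, 0 <= g x)%E ->
  (\int[P]_w g (X w) = \int[mu]_x (g x * (f x)%:E))%E.
Proof.
move=> mX mf f0 hX mg g0.
pose X' : {mfun W >-> T} := HB.pack X (isMeasurableFun.Build _ _ _ _ _ mX).
rewrite -(@ge0_integral_density _ _ _ mu (pushforward P X'))//.
by rewrite [RHS]ge0_integral_pushforward.
Qed.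

Lemma measurable_gbeta {R : realType} (beta : R) :
  measurable_fun [set: R] (gbeta beta).
Proof.
by apply: measurable_comp_powR; apply: measurable_funD => //; exact: exprn_measurable.
Qed.

Lemma Cbeta_ge0 {R : realType} (beta : R) : 0 <= Cbeta beta.
Proof.
rewrite invr_ge0 fine_ge0//; apply: integral_ge0 => x _.
by rewrite lee_fin powR_ge0.
Qed.

(** From 1 + x^2 <= (1 + |x|)^2, reversed by the negative exponent. *)
Lemma powR_1Dnorm_le_gbeta {R : realType} (beta x : R) : 0 <= beta ->
  (1 + `|x|) `^ (- (2 * beta)) <= gbeta beta x.
Proof.
move=> b0; have x0 := normr_ge0 x.
have c0 : 0 <= 1 + `|x| by rewrite addr_ge0.
rewrite /gbeta -mulrN powRrM !powRN lef_pV2 ?posrE ?powR_gt0 ?ltr_pwDl ?sqr_ge0//.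
apply: ge0_ler_powR; rewrite ?nnegrE ?powR_ge0 ?addr_ge0 ?sqr_ge0//.
by rewrite powR_mulrn// -[x ^+ 2]real_normK ?num_real//; nra.
Qed.

(** From (1 + |x|)^2 <= 2 (1 + x^2), that is (1 - |x|)^2 >= 0; raising the 2 to the power beta gives
    the constant. *)
Lemma gbeta_le_powR_1Dnorm {R : realType} (beta x : R) : 0 <= beta ->
  gbeta beta x <= 2 `^ beta * (1 + `|x|) `^ (- (2 * beta)).
Proof.
move=> b0; have x0 := normr_ge0 x.
have c0 : 0 <= 1 + `|x| by rewrite addr_ge0.
have g0 : 0 < 1 + x ^+ 2 by rewrite ltr_pwDl ?sqr_ge0.
rewrite /gbeta !powRN powRrM ler_pdivlMr ?powR_gt0 ?ltr_pwDl//.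
rewrite mulrC ler_pdivrMr ?powR_gt0// -powRM ?(ltW g0)//.
apply: ge0_ler_powR; rewrite ?nnegrE ?powR_ge0 ?mulr_ge0 ?(ltW g0)//.
rewrite powR_mulrn// -[x ^+ 2]real_normK ?num_real//.
by have := sqr_ge0 (1 - `|x|); nra.
Qed.

(** * Transfer of the Hardy inequality to the law of X *)

Theorem theorem4p2 (R : realType) (beta : R) (hbeta : 1 / 2 < beta)
  (d : measure_display) (T : measurableType d) (P : probability T R)
  (X : {RV P >-> R})
  (hX : forall A : set R, measurable A ->
          P (X @^-1` A) = (\int[lebesgue_measure]_(x in A) (fbeta beta x)%:E)%E)
  (p : R) (hp : 1 <= p) (phi : R -> R) (hphi : smooth phi)
  (hint : (\int[P]_w (`| phi (X w) | `^ p)%:E < +oo)%E) :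
  let m := fine (\int[P]_w (phi (X w))%:E) in
  (\int[P]_w (`| phi (X w) - m | `^ p)%:E <=
     (2 `^ beta * (2 * p / (2 * beta - 1)) `^ p)%:E *
     \int[P]_w ((1 + `| X w |) `^ p * `| (derive1 phi) (X w) | `^ p)%:E)%E.
Proof.
cbv zeta; set a := 2 * beta - 1.
have a0 : 0 < a by rewrite /a; lra.
have b0 : 0 <= beta by lra.
have p0 : 0 < p by rewrite (lt_le_trans _ hp).
have dphi (x : R) : is_derive x 1 phi (derive1 phi x).
  by apply: DeriveDef; [exact: hphi 0%N x|rewrite derive1E].
have cont (f : R -> R) : (forall x : R, derivable f x 1) -> continuous f.
  by move=> df x; apply/differentiable_continuous/derivable1_diffP.
have cphi : continuous phi by apply: cont => x; exact: (hphi 0%N x).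
have cdphi : continuous (derive1 phi) by apply: cont => x; exact: (hphi 1%N x).
have mphi := continuous_measurable_fun cphi.
have mdphi := continuous_measurable_fun cdphi.
have mg := measurable_gbeta beta.
have mw r : measurable_fun [set: R] (fun x : R => (1 + `|x|) `^ r).
  by apply: measurable_comp_powR; exact: measurable_funD.
pose F (x : R) := `|phi x - phi 0| `^ p.
pose D (x : R) := (1 + `|x|) `^ p * `|derive1 phi x| `^ p.
have F0 x : 0 <= F x by exact: powR_ge0.
have D0 x : 0 <= D x by rewrite mulr_ge0// powR_ge0.
have mF : measurable_fun [set: R] F.
  apply: measurable_comp_powR; apply: measurableT_comp => //.
  exact: measurable_funB.
have mD : measurable_fun [set: R] D.
  apply: measurable_funM; first exact: mw.
  by apply: measurable_comp_powR; exact: measurableT_comp.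
have C0 := Cbeta_ge0 beta.
have mfb : measurable_fun [set: R] (fbeta beta) by exact: measurable_funM.
have fb0 x : 0 <= fbeta beta x by rewrite mulr_ge0 ?powR_ge0.
have lawE (g : R -> R) : measurable_fun [set: R] g -> (forall x, 0 <= g x) ->
    (\int[P]_w (g (X w))%:E = \int[lebesgue_measure]_x (g x * fbeta beta x)%:E)%E.
  move=> mg' g0.
  (* The codomain of [X] is viewed as [measurableTypeR R] to match the domain of the Lebesgue
     measure. *)
  have mX : measurable_fun [set: T] (X : T -> measurableTypeR R).
    exact: (@measurable_funPT _ _ T R X).
  have := @ge0_integral_law_density _ _ T (measurableTypeR R) R P lebesgue_measure
    X (fbeta beta) (EFin \o g) mX mfb fb0 hX.
  by apply => //; exact/measurable_EFinP.
(* Recentring at phi(0), where the Hardy inequality is anchored, costs 2^p. *)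
apply: le_trans (central_powR_moment_le P (phi 0) hp _) _.
  exact: measurableT_comp.
rewrite (lawE F)// (lawE D)//.
(* Passing from the density to the Hardy weight costs 2^beta; the exponents agree because -a-1 = -2
   beta. *)
apply: (@le_trans _ _ ((2 `^ p)%:E * \int[lebesgue_measure]_x
    ((Cbeta beta * 2 `^ beta)%:E * (F x * (1 + `|x|) `^ (- a - 1))%:E))%E).
  rewrite lee_wpmul2l ?lee_fin ?powR_ge0//; apply: ge0_le_integral => //.
  - by move=> x _; rewrite lee_fin !mulr_ge0// powR_ge0.
  - by apply/measurable_EFinP/measurable_funM => //; exact: measurable_funM.
  - apply: emeasurable_funM => //; apply/measurable_EFinP/measurable_funM => //.
    exact: mw.
  - move=> x _; rewrite -EFinM lee_fin /fbeta mulrCA -mulrA ler_wpM2l//.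
    rewrite [leRHS]mulrCA ler_wpM2l//.
    have -> : - a - 1 = - (2 * beta) by rewrite /a; ring.
    exact: gbeta_le_powR_1Dnorm.
have mFw : measurable_fun [set: R] (fun x => F x * (1 + `|x|) `^ (- a - 1)).
  by apply: measurable_funM => //; exact: mw.
have mDw : measurable_fun [set: R] (fun x => D x * (1 + `|x|) `^ (- a - 1)).
  by apply: measurable_funM => //; exact: mw.
have mDf : measurable_fun [set: R] (fun x => D x * fbeta beta x).
  by apply: measurable_funM => //; exact: measurable_funM.
rewrite ge0_integralZl//; last 3 first.
- exact/measurable_EFinP.
- by move=> x _; rewrite lee_fin mulr_ge0// powR_ge0.
- by rewrite lee_fin mulr_ge0// powR_ge0.
apply: (@le_trans _ _ ((2 `^ p)%:E * ((Cbeta beta * 2 `^ beta)%:E *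
    (((p / a) `^ p)%:E * \int[lebesgue_measure]_x
      (D x * (1 + `|x|) `^ (- a - 1))%:E)))%E).
  rewrite lee_wpmul2l ?lee_fin ?powR_ge0//.
  rewrite lee_wpmul2l ?lee_fin ?mulr_ge0 ?powR_ge0//.
  exact: hardy_line.
(* The constant splits into its three sources: recentring, comparison of weights, Hardy. *)
have -> : (2 `^ beta * (2 * p / a) `^ p)%R =
    (2 `^ p * (2 `^ beta * (p / a) `^ p))%R.
  by rewrite -mulrA powRM ?divr_ge0 ?(ltW p0) ?(ltW a0)// mulrCA.
rewrite [in leRHS]EFinM -muleA lee_wpmul2l ?lee_fin ?powR_ge0//.
rewrite [in leLHS]EFinM [in leRHS]EFinM -!muleA muleCA lee_wpmul2l ?lee_fin ?powR_ge0//.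
rewrite muleCA lee_wpmul2l ?lee_fin ?powR_ge0//.
(* Returning from the Hardy weight to the density costs no constant, since the weight lies below
   [gbeta]. *)
rewrite -ge0_integralZl//; last 2 first.
- exact/measurable_EFinP.
- by move=> x _; rewrite lee_fin mulr_ge0// powR_ge0.
apply: ge0_le_integral => //.
- by move=> x _; rewrite lee_fin !mulr_ge0// powR_ge0.
- by apply: emeasurable_funM => //; exact/measurable_EFinP.
- exact/measurable_EFinP.
- move=> x _; rewrite -EFinM lee_fin /fbeta mulrCA ler_wpM2l// ler_wpM2l//.
  have -> : - a - 1 = - (2 * beta) by rewrite /a; ring.
  exact: powR_1Dnorm_le_gbeta.
Qed.
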